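(* Let $A\in\mathbb R^{n\times n}$ be Hurwitz, $B,v\in\mathbb R^n$ with $(A,B)$ controllable, and $\kappa>0$. Define $G(\mathrm j\omega)=(\mathrm j\omega I_n-A)^{-1}B$ and $$f(\omega,\kappa,\vartheta,v)=2\,\mathrm{Re}\{v^\top G(\mathrm j\omega)\}+\kappa|v^\top G(\mathrm j\omega)|^2-\vartheta\|G(\mathrm j\omega)\|^2 .$$ For $\psi>0$ consider the LMI in $P\in\mathrm S^n$: $$A^\top P+PA+(\psi+\kappa\|v\|^2)I_n-\kappa vv^\top\le0,\qquad PB=v, \tag{L}$$ and let $\Psi=\{\psi>0:\ (L)\text{ is feasible}\}$. Then $\Psi\neq\emptyset$ if and only if $f(\omega,\kappa,\kappa\|v\|^2,v)>0$ for all $\omega\in\mathbb R$ and $\lim_{\omega\to\infty}\|G(\mathrm j\omega)\|^{-2}f(\omega,\kappa,\kappa\|v\|^2,v)>0$. If $\Psi\neq\emptyset$, then every solution $P\in\mathrm S^n$ of (L) with $\psi\in\Psi$ satisfies $P>0$ and $Q:=-(A^\top P+PA)>0$. Moreover, for such $\psi$ and $P$, if there exists $\omega\in\mathbb R$ with $f(\omega,0,\psi+\kappa\|v\|^2,v)<0$, then $\lambda_{\min}(Q+PBB^\top P)>\lambda_{\min}(Q)$.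
   Context: $\mathrm S^n$: real symmetric $n\times n$ matrices, with Loewner order; $\mathrm j$ is the imaginary unit; $\|\cdot\|$ is the Euclidean norm on $\mathbb C^n$. *)

(* Defs.v *)
From HB Require Import structures.
From mathcomp Require Import all_boot all_order all_algebra.
From mathcomp Require Import all_classical all_reals.
From mathcomp Require Import topology normedtype.
From mathcomp Require Import complex.

Set Implicit Arguments.
Unset Strict Implicit.
Unset Printing Implicit Defensive.
Import Order.TTheory GRing.Theory Num.Theory.
Local Open Scope ring_scope.
Local Open Scope classical_set_scope.

Section Defs.
Variable R : realType.

Definition toC (x : R) : R[i] := Complex x 0.
Definition mxC {m p : nat} (M : 'M[R]_(m, p)) : 'M[R[i]]_(m, p) := map_mx toC M.

Definition hurwitz {n : nat} (A : 'M[R]_n) : Prop :=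
  forall z : R[i], eigenvalue (mxC A) z -> complex.Re z < 0.

Definition ctrb {n : nat} (A : 'M[R]_n) (B : 'cV[R]_n) : 'M[R]_n :=
  \matrix_(i, j) ((A ^+ j) *m B) i 0.

Definition controllable {n : nat} (A : 'M[R]_n) (B : 'cV[R]_n) : Prop :=
  \rank (ctrb A B) = n.

Definition transfer {n : nat} (A : 'M[R]_n) (B : 'cV[R]_n) (w : R) : 'cV[R[i]]_n :=
  invmx ((Complex 0 w)%:M - mxC A) *m mxC B.

Definition sqmod (z : R[i]) : R := complex.Re z ^+ 2 + complex.Im z ^+ 2.
Definition cnorm2 {n : nat} (x : 'cV[R[i]]_n) : R := \sum_i sqmod (x i 0).
Definition rnorm2 {n : nat} (x : 'cV[R]_n) : R := \sum_i x i 0 ^+ 2.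

Definition ffun_ {n : nat} (A : 'M[R]_n) (B : 'cV[R]_n)
    (w kappa theta : R) (v : 'cV[R]_n) : R :=
  let G := transfer A B w in
  let s := ((mxC v)^T *m G) 0 0 in
  2 * complex.Re s + kappa * sqmod s - theta * cnorm2 G.

Definition sym_mx {n : nat} (P : 'M[R]_n) : Prop := P^T = P.
Definition nsd {n : nat} (M : 'M[R]_n) : Prop :=
  sym_mx M /\ forall x : 'cV[R]_n, (x^T *m M *m x) 0 0 <= 0.
Definition posdef {n : nat} (M : 'M[R]_n) : Prop :=
  sym_mx M /\ forall x : 'cV[R]_n, x != 0 -> 0 < (x^T *m M *m x) 0 0.

Definition LMI {n : nat} (A : 'M[R]_n) (B v : 'cV[R]_n) (kappa psi : R)
    (P : 'M[R]_n) : Prop :=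
  nsd (A^T *m P + P *m A + (psi + kappa * rnorm2 v)%:M - kappa *: (v *m v^T))
  /\ P *m B = v.

Definition PsiSet {n : nat} (A : 'M[R]_n) (B v : 'cV[R]_n) (kappa : R) : set R :=
  [set psi | 0 < psi /\ exists P : 'M[R]_n, sym_mx P /\ LMI A B v kappa psi P].

Definition lambda_min {n : nat} (M : 'M[R]_n) : R :=
  inf [set l : R | eigenvalue M l].

End Defs.

(* Main.v *)
Require Import Defs.
From HB Require Import structures.
From mathcomp Require Import all_boot all_order all_algebra.
From mathcomp Require Import all_classical all_reals.
From mathcomp Require Import topology normedtype derive.
From mathcomp Require Import complex spectral sesquilinear.
From mathcomp Require Import ring lra zify.
Import Order.TTheory GRing.Theory Num.Theory.
Import numFieldNormedType.Exports.
Set Implicit Arguments.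
Unset Strict Implicit.
Unset Printing Implicit Defensive.
Local Open Scope ring_scope.
Local Open Scope classical_set_scope.

(** The frequency condition gives the LMI by spectral factorization. Write
    a = char_poly A and G(s) = N(s)/a(s) with N = adj(s - A) B. Multiplied by
    |a(jw)|^2, both f and |G|^2 become even real polynomials in w of degree at
    most 2(dim A - 1), and the hypotheses yield psi > 0 with f - psi |G|^2 > 0.
    Then f - psi |G|^2 = |H(w)|^2 / |a(jw)|^2 with H a complex polynomial, and
    by controllability H(w) = c N(jw) for some row c. Let S be the real part of
    c^* c and let P solve the Lyapunov equation turning the LMI into equality
    with -S. The identity G^* (A^T P + P A) G = - 2 Re (B^T P G) then forces
    Re ((P B - v)^T G(jw)) = 0 for all w, hence P B = v since a(s) and a(-s) are
    coprime. The same identity gives the converse and the eigenvalue claim: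
    if adding v v^T did not increase the least eigenvalue mu of Q, the LMI at a
    minimizing eigenvector (which is orthogonal to v) would give
    mu >= psi + kappa |v|^2, and then f(w, 0, psi + kappa |v|^2) >= 0. *)

Local Notation toCR R := (real_complex R).
Local Notation "M ^t*" := (map_mx Num.conj M^T) (at level 30).

(** * The polynomial numerator of the resolvent and controllability *)

Definition resnum (K : fieldType) n (A : 'M[K]_n) (B : 'cV[K]_n) : 'cV[{poly K}]_n :=
  \adj (char_poly_mx A) *m map_mx polyC B.

(** This is [(X - A) adj(X - A) B = a(X) B], rearranged. Degrees, kernel, top coefficients and
    values of [resnum] are all read off from it. *)
Lemma resnumE (K : fieldType) n (A : 'M[K]_n) (B : 'cV[K]_n) :
  'X *: resnum A B = map_mx polyC A *m resnum A B + char_poly A *: map_mx polyC B.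
Proof.
have : char_poly_mx A *m resnum A B = char_poly A *: map_mx polyC B.
  by rewrite /resnum mulmxA mul_mx_adj mul_scalar_mx.
by rewrite {1}/char_poly_mx mulmxBl mul_scalar_mx => <-; rewrite addrC subrK.
Qed.

Lemma map_resnum (K L : fieldType) (f : {rmorphism K -> L}) n (A : 'M[K]_n)
    (B : 'cV[K]_n) :
  resnum (map_mx f A) (map_mx f B) = map_mx (map_poly f) (resnum A B).
Proof.
rewrite /resnum map_mxM map_mx_adj map_char_poly_mx; congr (_ *m _).
by apply/matrixP=> i j; rewrite !mxE /= map_polyC.
Qed.

(** At an entry of largest size, the left side of [resnumE] gains one in size, while the right side
    stays within the maximum of that size and [n.+1]. *)
Lemma size_resnum (K : fieldType) n (A : 'M[K]_n) (B : 'cV[K]_n) i :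
  (size (resnum A B i 0%R) <= n)%N.
Proof.
set N := resnum A B.
have [k _ kmax] := @arg_maxnP _ i xpredT (fun j => size (N j 0%R)) isT.
apply: leq_trans (kmax i isT) _; rewrite leqNgt; apply/negP=> ltnk.
have Nk0 : N k 0 != 0 by rewrite -size_poly_gt0 (leq_ltn_trans _ ltnk).
have /matrixP/(_ k 0) := resnumE A B; rewrite -/N mxE [RHS]mxE => eqk.
have /esym/eqP := congr1 (fun p : {poly K} => size p) eqk.
apply/negP; rewrite neq_ltn; apply/orP; left.
rewrite [in X in (_ < X)%N]mulrC size_mulX // ltnS; apply: leq_trans (size_polyD _ _) _.
rewrite geq_max; apply/andP; split.
  rewrite mxE; apply: leq_trans (size_sum _ _ _) _; apply/bigmax_leqP=> j _.
  rewrite mxE mul_polyC; apply: leq_trans (size_scale_leq _ _) (kmax j isT).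
have -> : (char_poly A *: map_mx polyC B) k 0 = B k 0 *: char_poly A.
  by rewrite !mxE mulrC mul_polyC.
by apply: leq_trans (size_scale_leq _ _) _; rewrite size_char_poly.
Qed.

Lemma mulmx_polyC_rV (K : fieldType) n (c : 'rV[K]_n) (N : 'cV[{poly K}]_n) :
  (map_mx polyC c *m N) 0 0 = \sum_j c 0 j *: N j 0.
Proof. by rewrite mxE; apply: eq_bigr => j _; rewrite mxE mul_polyC. Qed.

Lemma size_mul_resnum (K : fieldType) n (A : 'M[K]_n) (B : 'cV[K]_n) (c : 'rV[K]_n) :
  (size ((map_mx polyC c *m resnum A B)%R 0%R 0%R) <= n)%N.
Proof.
rewrite mulmx_polyC_rV; apply: leq_trans (size_sum _ _ _) _; apply/bigmax_leqP=> j _.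
exact: leq_trans (size_scale_leq _ _) (size_resnum _ _ _).
Qed.

(** Multiplying [resnumE] by [c] on the left gives [0 = c A N + a (c B)]. The first term has size at
    most [n] and [a] has size [n.+1], so both terms vanish, and the argument repeats with [c A]. *)
Lemma resnum_kernel (K : fieldType) n (A : 'M[K]_n) (B : 'cV[K]_n) (c : 'rV[K]_n) :
  map_mx polyC c *m resnum A B = 0 -> forall k, c *m A ^+ k *m B = 0.
Proof.
have step (d : 'rV[K]_n) : map_mx polyC d *m resnum A B = 0 ->
    d *m B = 0 /\ map_mx polyC (d *m A) *m resnum A B = 0.
  move=> dN.
  have /(congr1 (mulmx (map_mx polyC d))) := resnumE A B.
  rewrite -scalemxAr dN scaler0 mulmxDr -scalemxAr mulmxA -!map_mxM /=.
  set q := map_mx _ _ *m resnum _ _ => eq0.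
  have q0 : q 0 0 = - (char_poly A * ((d *m B) 0 0)%:P).
    by apply/eqP; rewrite -addr_eq0; move/matrixP/(_ 0 0): eq0; rewrite !mxE => <-.
  have dB0 : (d *m B) 0 0 = 0.
    apply/eqP; case: eqVneq => // dB.
    have := size_mul_resnum A B (d *m A); rewrite -/q.
    by rewrite q0 size_polyN mulrC mul_polyC size_scale // size_char_poly ltnn.
  split; first by apply/matrixP=> i j; rewrite !ord1 dB0 mxE.
  by apply/matrixP=> i j; rewrite !ord1 q0 dB0 mulr0 oppr0 mxE.
move=> cN k.
suff /step[] : map_mx polyC (c *m A ^+ k) *m resnum A B = 0 by [].
elim: k => [|k /step[_ IH]]; first by rewrite expr0 -idmxE mulmx1.
by rewrite exprSr -mulmxE mulmxA.
Qed.

(** By [resnum_kernel], [c] annihilates every column of the Kalman matrix. The rank condition is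
    spelled out because it serves over both [R] and [R[i]]. *)
Lemma resnum_inj (K : fieldType) n (A : 'M[K]_n) (B : 'cV[K]_n) :
  \rank (\matrix_(i, j) ((A ^+ j) *m B) i 0 : 'M_n) = n ->
  forall c : 'rV[K]_n, map_mx polyC c *m resnum A B = 0 -> c = 0.
Proof.
move=> rkn c cN; set Kr := \matrix_(i, j) _ in rkn.
have free : row_free Kr by rewrite /row_free rkn.
apply/eqP; rewrite -(mulmx_free_eq0 _ free); apply/eqP/matrixP=> i j.
have cAB := congr1 (fun M : 'M_1 => M i 0) (resnum_kernel cN j).
rewrite [RHS]mxE; apply: etrans (etrans cAB (mxE _ _ _ _)); rewrite -mulmxA mxE [RHS]mxE.
by apply: eq_bigr => k _; rewrite mxE.
Qed.

(** The coefficient matrix of the [n] entries of [resnum] is square and has trivial kernel by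
    [resnum_inj], so these entries form a basis of the polynomials of size at most [n]. *)
Lemma resnum_surj (K : fieldType) n (A : 'M[K]_n) (B : 'cV[K]_n) :
  \rank (\matrix_(i, j) ((A ^+ j) *m B) i 0 : 'M_n) = n ->
  forall h : {poly K}, (size h <= n)%N ->
  exists c : 'rV[K]_n, (map_mx polyC c *m resnum A B) 0 0 = h.
Proof.
move=> rkn h hn; pose M : 'M[K]_n := \matrix_(i, k) (resnum A B i 0)`_k.
have cM (c : 'rV_n) (k : 'I_n) : (c *m M) 0 k = ((map_mx polyC c *m resnum A B) 0 0)`_k.
  by rewrite mulmx_polyC_rV coef_sum mxE; apply: eq_bigr => j _; rewrite mxE coefZ.
have polyeq (p q : {poly K}) : (size p <= n)%N -> (size q <= n)%N ->
    (forall k : 'I_n, p`_k = q`_k) -> p = q.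
  move=> pn qn pq; apply/polyP=> k; case: (ltnP k n) => kn.
    exact: (pq (Ordinal kn)).
  by rewrite !nth_default // (leq_trans _ kn).
have Mu : M \in unitmx.
  rewrite -row_free_unit -kermx_eq0; apply/eqP/row_matrixP=> i; rewrite row0.
  apply: (resnum_inj rkn); apply/matrixP=> x y; rewrite !ord1 [RHS]mxE.
  apply: polyeq; [exact: size_mul_resnum|by rewrite size_poly0|move=> k].
  by rewrite -cM -row_mul mulmx_ker row0 mxE coef0.
exists ((\row_(k < n) h`_k) *m invmx M).
apply: polyeq (size_mul_resnum _ _ _) hn _ => k.
by rewrite -cM mulmxKV // mxE.
Qed.

(** * Spectral factorization of a positive real polynomial *)

Lemma sqmodM (R : realType) (z w : R[i]) : sqmod (z * w) = sqmod z * sqmod w.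
Proof. by case: z w => [a b] [c d]; rewrite /sqmod /=; ring. Qed.

Lemma sqmod_real (R : realType) (c : R) : sqmod (toCR R c) = c ^+ 2.
Proof. by rewrite /sqmod /= expr0n addr0. Qed.

Lemma horner_complex_real (R : realType) (p : {poly R}) (x : R) :
  (map_poly (toCR R) p).[toCR R x] = toCR R p.[x].
Proof. by rewrite horner_map. Qed.

(** Induction on the size: a complex root [z] of [p] is not real by positivity, so the real
    quadratic [q] with roots [z] and its conjugate divides [p]. On the real line [q] is the squared
    modulus of [x - z], and ['X - z] goes into [H]. The size bound says that [H] has at most half
    the degree of [p]. *)
Lemma spectral_factor (R : realType) (p : {poly R}) :
  (forall x, 0 < p.[x]) ->
  exists H : {poly R[i]},
    (forall x, sqmod H.[toCR R x] = p.[x]) /\ ((size H).*2 <= (size p).+1)%N.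
Proof.
have [m] := ubnP (size p); elim: m p => // m IH p; rewrite ltnS => szp p_gt0.
have [sz1|sz_gt1] := leqP (size p) 1.
  have pE := size1_polyC sz1; exists (toCR R (Num.sqrt p`_0))%:P; split=> [x|].
    rewrite hornerC sqmod_real sqr_sqrtr; first by rewrite pE hornerC coefC.
    by have := p_gt0 0; rewrite horner_coef0 => /ltW.
  rewrite (leq_trans (n := 2)) //; first by rewrite (leq_double _ 1) size_polyC leq_b1.
  rewrite ltnS size_poly_gt0; apply: contraTneq (p_gt0 0) => ->.
  by rewrite horner0 ltxx.
have /closed_rootP[z pz] : size (map_poly (toCR R) p) != 1%N.
  by rewrite size_map_poly gtn_eqF.
have zE : z = Complex (complex.Re z) (complex.Im z) by case: (z).
set a := complex.Re z in zE; set b := complex.Im z in zE.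
have b0 : b != 0.
  apply/negP=> /eqP b0; move: pz; rewrite zE b0 complexr0 /root horner_complex_real.
  by rewrite (inj_eq (@complexI R)) gt_eqF.
pose q : {poly R} := ('X - a%:P) ^+ 2 + (b ^+ 2)%:P.
have szq : size q = 3%N.
  by rewrite size_polyDl size_exp_XsubC // size_polyC; case: (_ != 0).
have q0 : q != 0 by rewrite -size_poly_gt0 szq.
have qx x : q.[x] = sqmod (toCR R x - z).
  by rewrite zE /q !hornerE /sqmod /=; ring.
have q_gt0 x : 0 < q.[x].
  rewrite /q !hornerE ltr_wpDl ?sqr_ge0 // exprn_even_gt0 //.
have qz : root (map_poly (toCR R) q) z.
  rewrite /root /q rmorphD rmorphXn rmorphB /= map_polyX !map_polyC /= !hornerE.
  rewrite zE; simpc; rewrite eq_complex /=.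
  by apply/andP; split; apply/eqP; rewrite ?subrr /=; ring.
(* The remainder is real, of degree at most one, and vanishes at the nonreal [z]. *)
have pmod0 : p %% q = 0.
  set r := p %% q.
  have szr : (size r < 3)%N by rewrite -szq ltn_modp.
  have rz : root (map_poly (toCR R) r) z.
    move: pz; rewrite {1}(divp_eq p q) rmorphD rmorphM /= /root !hornerE.
    by rewrite (eqP qz) mulr0 add0r.
  have rE : r = (r`_1) *: 'X + (r`_0)%:P.
    apply/polyP=> -[|[|k]]; rewrite coefD coefZ coefX coefC ?mulr0 ?mulr1 ?addr0 ?add0r //=.
    by rewrite nth_default //; apply: leq_trans (_ : 2 <= _)%N; rewrite // -ltnS.
  move: rz; rewrite {1}rE rmorphD /= map_polyZ map_polyX map_polyC /= /root !hornerE.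
  rewrite zE eq_complex /= => /andP[].
  rewrite !(mul0r, mulr0, addr0, subr0, add0r) => e1 e2.
  have r1 : r`_1 = 0 by apply/eqP; move: e2; rewrite mulf_eq0 (negPf b0) orbF.
  have r0 : r`_0 = 0 by apply/eqP; move: e1; rewrite r1 mul0r add0r.
  by rewrite [LHS]rE r1 r0 scale0r add0r polyC0.
have pE : p = p %/ q * q by rewrite {1}(divp_eq p q) pmod0 addr0.
have p1_gt0 x : 0 < (p %/ q).[x].
  by have := p_gt0 x; rewrite {1}pE hornerM pmulr_lgt0.
have p10 : p %/ q != 0.
  by apply: contraTneq (p1_gt0 0) => ->; rewrite horner0 ltxx.
have szp1 : size p = (size (p %/ q)).+2.
  by rewrite {1}pE size_mul // szq addnC.
have [] := IH (p %/ q) _ p1_gt0; first by rewrite szp1 in szp; apply: leq_trans szp.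
move=> H [HE szH]; exists (('X - z%:P) * H); split=> [x|].
  by rewrite hornerM sqmodM HE hornerXsubC -qx mulrC -hornerM -pE.
have [->|H0] := eqVneq H 0; first by rewrite mulr0 size_poly0.
by rewrite size_monicM ?monicXsubC // size_XsubC doubleS szp1 !ltnS.
Qed.

(** * Real and imaginary parts of a real polynomial on the imaginary axis *)

Definition axis_re (R : realType) (p : {poly R}) : {poly R} :=
  \poly_(k < size p) (p`_k * complex.Re ('i%C ^+ k : R[i])).
Definition axis_im (R : realType) (p : {poly R}) : {poly R} :=
  \poly_(k < size p) (p`_k * complex.Im ('i%C ^+ k : R[i])).

Lemma size_axis_re (R : realType) (p : {poly R}) : (size (axis_re p) <= size p)%N.
Proof. exact: size_poly. Qed.

Lemma size_axis_im (R : realType) (p : {poly R}) : (size (axis_im p) <= size p)%N.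
Proof. exact: size_poly. Qed.

Lemma horner_axis (R : realType) (p : {poly R}) (w : R) :
  (map_poly (toCR R) p).[Complex 0 w] = Complex (axis_re p).[w] (axis_im p).[w].
Proof.
rewrite /axis_re /axis_im !horner_poly.
have -> : Complex 0 w = 'i%C * toCR R w by simpc.
rewrite [RHS]complexE !rmorph_sum /= mulr_sumr -big_split /=; apply: eq_bigr => k _.
rewrite exprMn -!rmorphXn /= !rmorphM /= [in LHS](complexE ('i%C ^+ k)).
by ring.
Qed.

Lemma horner_conj (R : realType) (p : {poly R}) (z : R[i]) :
  (map_poly (toCR R) p).[conjc z] = conjc (map_poly (toCR R) p).[z].
Proof.
rewrite !horner_coef !size_map_poly rmorph_sum /=; apply: eq_bigr => k _.
by rewrite rmorphM rmorphXn coef_map /= oppr0.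
Qed.

(** The coefficients are real, so passing from [w] to [- w] conjugates [p(jw)]. *)
Lemma axis_re_even (R : realType) (p : {poly R}) (w : R) : (axis_re p).[- w] = (axis_re p).[w].
Proof.
have := horner_conj p (Complex 0 w); rewrite /= !horner_axis /=.
by move=> /(congr1 (@complex.Re R)).
Qed.

Lemma axis_im_odd (R : realType) (p : {poly R}) (w : R) :
  (axis_im p).[- w] = - (axis_im p).[w].
Proof.
have := horner_conj p (Complex 0 w); rewrite /= !horner_axis /=.
by move=> /(congr1 (@complex.Im R)).
Qed.

Lemma horner_ext (R : realType) (p q : {poly R}) : (forall x, p.[x] = q.[x]) -> p = q.
Proof.
move=> pq; apply/eqP; rewrite -subr_eq0; apply/negPn/negP=> d0.
pose rs := [seq (k%:R : R) | k <- iota 0 (size (p - q))].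
suff : (size rs < size (p - q)%R)%N by rewrite size_map size_iota ltnn.
apply: max_poly_roots => //.
  by apply/allP=> x _; rewrite /root !hornerE pq subrr.
by rewrite map_inj_uniq ?iota_uniq // => i j /eqP; rewrite eqr_nat => /eqP.
Qed.

(** Serves to remove an odd top coefficient in [size_axis_ffun]. *)
Lemma coef_odd_even_poly (R : realType) (p : {poly R}) :
  (forall x, p.[- x] = p.[x]) -> forall k, odd k -> p`_k = 0.
Proof.
move=> pe k ok.
have pE : p = \poly_(i < size p) ((-1) ^+ i * p`_i).
  apply: horner_ext => x; rewrite -pe horner_poly horner_coef.
  by apply: eq_bigr => i _; rewrite -(mulN1r x) exprMn mulrCA mulrA.
have : p`_k = - p`_k.
  rewrite [LHS](congr1 (fun q : {poly R} => q`_k) pE) coef_poly.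
  case: ltnP => kp; first by rewrite -signr_odd ok expr1 mulN1r.
  by rewrite nth_default // oppr0.
by move/eqP; rewrite -addr_eq0 -mulr2n -mulr_natr mulf_eq0 pnatr_eq0 orbF => /eqP.
Qed.

(** * Hurwitz matrices and solvability of the Lyapunov equation *)

Lemma mxCE (R : realType) m p (M : 'M[R]_(m, p)) : mxC M = map_mx (toCR R) M.
Proof. by []. Qed.

Lemma hurwitz_root (R : realType) n (A : 'M[R]_n) (z : R[i]) :
  hurwitz A -> root (map_poly (toCR R) (char_poly A)) z -> complex.Re z < 0.
Proof. by move=> hA rz; apply: hA; rewrite eigenvalue_root_char mxCE -map_char_poly. Qed.

(** At a common complex root [z], both [z] and [- z] would have negative real part. *)
Lemma hurwitz_coprime (R : realType) n (A : 'M[R]_n) :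
  hurwitz A -> coprimep (char_poly A) (char_poly A \Po (- 'X)).
Proof.
move=> hA; rewrite /coprimep; set d := gcdp _ _; apply/negPn/negP => szd.
have /closed_rootP[z dz] : size (map_poly (toCR R) d) != 1%N by rewrite size_map_poly.
have az : complex.Re z < 0.
  apply: (hurwitz_root hA); apply: root_dvdp dz.
  by rewrite dvdp_map dvdp_gcdl.
have : complex.Re (- z) < 0.
  apply: (hurwitz_root hA).
  have : root (map_poly (toCR R) (char_poly A \Po - 'X)) z.
    by apply: root_dvdp dz; rewrite dvdp_map dvdp_gcdr.
  by rewrite map_comp_poly /= rmorphN /= map_polyX /root horner_comp !hornerE.
by move: az; case: z {dz} => x y /=; lra.
Qed.

Lemma char_poly_trmx (K : fieldType) n (A : 'M[K]_n) : char_poly A^T = char_poly A.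
Proof.
rewrite /char_poly -det_tr; congr (\det _).
by apply/matrixP=> i j; rewrite !mxE eq_sym.
Qed.

(** From [A^T P = - P A] follows [p(A^T) P = P p(- A)] for every polynomial [p]. For the
    characteristic polynomial the left side is zero by Cayley-Hamilton, and [a(- A)] is invertible
    by the Bezout relation between [a(s)] and [a(- s)]. *)
Lemma lyapunov_inj (R : realType) n (A P : 'M[R]_n.+1) :
  hurwitz A -> A^T *m P + P *m A = 0 -> P = 0.
Proof.
move=> hA /eqP; rewrite addr_eq0 => /eqP AP.
have PA p : P *m horner_mx A (p \Po - 'X) = horner_mx A^T p *m P.
  elim/poly_ind: p => [|p c IH].
    by rewrite comp_poly0 !rmorph0 mulmx0 mul0mx.
  rewrite comp_poly_MXaddC !rmorphD !rmorphM rmorphN /= !horner_mx_X !horner_mx_C.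
  rewrite mulmxDr mulmxDl scalar_mxC; congr (_ + _).
  by rewrite -!mulmxE mulmxA IH -!mulmxA AP mulmxN.
have /Bezout_eq1_coprimepP[[u1 u2] /= uE] := hurwitz_coprime hA.
have := congr1 (horner_mx A) uE.
rewrite rmorphD !rmorphM /= Cayley_Hamilton mulr0 add0r rmorph1 => u2E.
have : P *m horner_mx A (char_poly A \Po - 'X) = 0.
  by rewrite PA -char_poly_trmx Cayley_Hamilton mul0mx.
move=> /(congr1 (mulmx^~ (horner_mx A u2))); rewrite mul0mx -mulmxA mulmxE.
by rewrite -rmorphM mulrC rmorphM u2E mulr1.
Qed.

(** An injective endomorphism of the finite-dimensional space of matrices is onto; the solution is
    symmetric by uniqueness, since its transpose solves the same equation. *)
Lemma lyapunov_solve (R : realType) n (A S : 'M[R]_n.+1) :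
  hurwitz A -> sym_mx S -> exists2 P, sym_mx P & A^T *m P + P *m A = S.
Proof.
move=> hA symS.
pose f : {linear 'M[R]_n.+1 -> 'M[R]_n.+1} := (mulmx A^T \+ mulmxr A)%R.
have fE P : f P = A^T *m P + P *m A by [].
have inj : row_free (lin_mx f).
  rewrite -kermx_eq0; apply/eqP/row_matrixP=> i; rewrite row0.
  rewrite -[LHS]vec_mxK; apply/eqP; rewrite mxvec_eq0; apply/eqP.
  apply: (lyapunov_inj hA); rewrite -fE; apply: (can_inj mxvecK).
  by rewrite -mul_vec_lin vec_mxK -row_mul mulmx_ker row0 linear0.
rewrite row_free_unit in inj.
pose P := vec_mx (mxvec S *m invmx (lin_mx f)).
have PE : A^T *m P + P *m A = S.
  rewrite -fE; apply: (can_inj mxvecK).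
  by rewrite -mul_vec_lin vec_mxK mulmxKV.
exists P => //; rewrite /sym_mx; apply/eqP; rewrite -subr_eq0; apply/eqP.
apply: (lyapunov_inj hA); rewrite mulmxBr mulmxBl addrACA -opprD.
suff -> : A^T *m P^T + P^T *m A = S by rewrite PE subrr.
by rewrite -[RHS]symS -PE linearD /= !trmx_mul trmxK addrC.
Qed.

(** * Positive definiteness of Lyapunov solutions *)

Lemma conjtM (C : numClosedFieldType) m n p (M : 'M[C]_(m, n)) (N : 'M_(n, p)) :
  (M *m N)^t* = N^t* *m M^t*.
Proof. by rewrite trmx_mul map_mxM. Qed.

Lemma conjtD (C : numClosedFieldType) m n (M N : 'M[C]_(m, n)) :
  (M + N)^t* = M^t* + N^t*.
Proof. by rewrite linearD /= map_mxD. Qed.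

(** Induction on the dimension. The first basis row [e] satisfies [e T = l e], so the hypothesis at
    [e] makes the corner [p0] of [P] positive. The hypotheses then pass to the lower right block of
    [T] and the Schur complement of [p0] in [P]. *)
Lemma lyapunov_trig (C : numClosedFieldType) n (T P : 'M[C]_n) :
  is_trig_mx T -> (forall i, T i i + (T i i)^* < 0) -> P^t* = P ->
  (forall x : 'rV_n, x != 0 -> (x *m (T *m P + P *m T^t*) *m x^t*) 0 0 < 0) ->
  forall x : 'rV_n, x != 0 -> 0 < (x *m P *m x^t*) 0 0.
Proof.
elim: n T P => [|n IH] T P trigT reT hP neg x x0.
  by rewrite [x]thinmx0 eqxx in x0.
rewrite -[n.+1]/(1 + n)%N in T P trigT reT hP neg x x0 *.
pose l := T 0 0; pose p0 := P 0 0; pose q := ursubmx P; pose P' := drsubmx P.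
pose t := dlsubmx T; pose T' := drsubmx T.
have PE : P = block_mx p0%:M q (q^t*) P'.
  rewrite -[LHS]submxK; congr block_mx.
    by rewrite [LHS]mx11_scalar; congr (_%:M); rewrite !mxE !lshift0.
  rewrite -[in LHS]hP; by apply/matrixP=> i j; rewrite !mxE.
have TE : T = block_mx l%:M 0 t T'.
  rewrite -[LHS]submxK; congr block_mx.
    by rewrite [LHS]mx11_scalar; congr (_%:M); rewrite !mxE !lshift0.
  apply/matrixP=> i j; rewrite !mxE; move/is_trig_mxP: trigT; apply.
  by rewrite /= ord1.
have hP' : P'^t* = P' by rewrite /P' -[in RHS]hP; apply/matrixP=> i j; rewrite !mxE.
have p0_real : p0^* = p0 by rewrite /p0 -[in RHS]hP !mxE.
pose e : 'rV[C]_(1 + n) := row_mx 1%:M 0.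
have eP : e *m P = row_mx p0%:M q.
  by rewrite PE mul_row_block !mul1mx !mul0mx !addr0.
have ePe : e *m P *m e^t* = p0%:M.
  rewrite eP tr_row_mx map_col_mx mul_row_col trmx0 map_mx0 mulmx0 addr0.
  by rewrite trmx1 map_mx1 mulmx1.
have p0_gt0 : 0 < p0.
  have e0 : e != 0.
    by apply/eqP => /matrixP/(_ 0 (lshift n 0)) /eqP; rewrite row_mxEl !mxE eqxx oner_eq0.
  have := neg _ e0.
  have -> : e *m (T *m P + P *m T^t*) *m e^t* = (p0 * (l + l^*))%:M.
    have eT : e *m T = l *: e.
      rewrite TE mul_row_block !mul1mx !mul0mx !addr0 scale_row_mx scaler0.
      by rewrite scalemx1.
    rewrite mulmxDr mulmxDl [e *m (T *m P)]mulmxA eT -!scalemxAl ePe.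
    have -> : e *m (P *m T^t*) *m e^t* = (e *m T *m (P *m e^t*))^t*.
      by rewrite !conjtM hP trmxCK !mulmxA.
    rewrite eT -scalemxAl [e *m (P *m _)]mulmxA ePe !scale_scalar_mx.
    rewrite tr_scalar_mx map_scalar_mx /= [(l * p0)^*]rmorphM /= p0_real -raddfD /=.
    by congr (_%:M); ring.
  by rewrite mxE eqxx mulr1n nmulr_llt0 // reT.
have p00 : p0 != 0 by rewrite gt_eqF.
pose P'' := P' - p0^-1 *: (q^t* *m q).
(* The lift of [z] orthogonal to [e] with respect to [P]: the first entry of [y z *m P] is zero, so
   the first entry of [y z *m T] never contributes. *)
pose y (z : 'rV[C]_n) : 'rV[C]_(1 + n) := row_mx (- p0^-1 *: (z *m q^t*)) z.
have yP z : y z *m P = row_mx 0 (z *m P'').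
  rewrite PE mul_row_block mul_mx_scalar scalerA mulrN divff // scaleN1r addNr.
  by rewrite -scalemxAl scaleNr addrC mulmxBr -scalemxAr mulmxA.
have hP'' : P''^t* = P''.
  rewrite /P'' linearB /= map_mxB hP' linearZ /= map_mxZ conjtM trmxCK.
  by rewrite fmorphV /= p0_real.
have yPy z : y z *m P *m (y z)^t* = z *m P'' *m z^t*.
  by rewrite yP tr_row_mx map_col_mx mul_row_col mul0mx add0r.
have yT z : y z *m T = row_mx (l *: (- p0^-1 *: (z *m q^t*)) + z *m t) (z *m T').
  by rewrite TE mul_row_block mul_mx_scalar mulmx0 add0r.
clearbody P''.
have P''_gt0 : forall z : 'rV_n, z != 0 -> 0 < (z *m P'' *m z^t*) 0 0.
  apply: (IH T') => //.
  - apply/is_trig_mxP=> i j ij; rewrite !mxE; move/is_trig_mxP: trigT; apply.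
    by rewrite -(ltn_add2l 1) in ij.
  - by move=> i; rewrite !mxE.
  move=> z z0.
  have y0 : y z != 0.
    apply: contraNneq z0; rewrite /y -row_mx0 => /eq_row_mx[_ ->]; exact: eqxx.
  have := neg _ y0.
  have TPy : y z *m T *m P *m (y z)^t* = z *m T' *m P'' *m z^t*.
    rewrite -mulmxA -{1}hP -conjtM yP yT tr_row_mx map_col_mx trmx0 map_mx0.
    by rewrite mul_row_col mulmx0 add0r conjtM hP'' !mulmxA.
  have PTy : y z *m P *m T^t* *m (y z)^t* = z *m P'' *m T'^t* *m z^t*.
    rewrite -mulmxA -conjtM yP yT tr_row_mx map_col_mx mul_row_col mul0mx add0r.
    by rewrite conjtM !mulmxA.
  by rewrite !mulmxDr !mulmxDl !mulmxA TPy PTy.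
pose z := rsubmx x; pose al := (lsubmx x 0 0 + p0^-1 * (z *m q^t*) 0 0).
have xE : x = al *: e + y z.
  rewrite -[LHS]hsubmxK /y /e scale_row_mx scaler0 add_row_mx add0r; congr row_mx.
  rewrite -/z [z *m _]mx11_scalar [LHS]mx11_scalar scalemx1 scale_scalar_mx -raddfD /al.
  by congr (_%:M); ring.
have xPx : x *m P *m x^t* = (p0 * (al * al^*))%:M + z *m P'' *m z^t*.
  have yPe : y z *m P *m e^t* = 0.
    by rewrite yP tr_row_mx map_col_mx mul_row_col mul0mx trmx0 map_mx0 mulmx0 addr0.
  have ePy : e *m P *m (y z)^t* = 0.
    have -> : e *m P *m (y z)^t* = (y z *m P *m e^t*)^t*.
      by rewrite !conjtM hP trmxCK mulmxA.
    by rewrite yPe trmx0 map_mx0.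
  rewrite xE conjtD !mulmxDl !mulmxDr yPy linearZ /= map_mxZ -!scalemxAr -!scalemxAl.
  by rewrite ePe ePy yPe !scaler0 addr0 add0r !scale_scalar_mx; congr (_%:M + _); ring.
rewrite xPx mxE [(_%:M) 0 0]mxE eqxx mulr1n.
have [z0|z0] := eqVneq z 0.
  rewrite z0 !mul0mx mxE addr0 pmulr_rgt0 // mul_conjC_gt0.
  apply: contraNneq x0 => al0; rewrite xE al0 scale0r add0r z0 /y mul0mx scaler0.
  by rewrite row_mx0.
by rewrite ltr_wpDl ?P''_gt0 // mulr_ge0 ?(ltW p0_gt0) ?mul_conjC_ge0.
Qed.

Lemma mxC_conjt (R : realType) m p (M : 'M[R]_(m, p)) : (mxC M)^t* = mxC M^T.
Proof. by apply/matrixP=> i j; rewrite !mxE; exact: conjc_real. Qed.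

Lemma hermE (R : realType) n (M : 'M[R]_n) (x y : 'rV[R]_n) : M^T = M ->
  (mxC x + 'i%C *: mxC y) *m mxC M *m (mxC x + 'i%C *: mxC y)^t* =
  mxC (x *m M *m x^T + y *m M *m y^T).
Proof.
move=> symM.
have cross : x *m M *m y^T = y *m M *m x^T.
  by rewrite [LHS]mx11_scalar -tr_scalar_mx -mx11_scalar !trmx_mul symM trmxK mulmxA.
rewrite conjtD linearZ /= map_mxZ !mxC_conjt !mxCE !mulmxDl !mulmxDr -!scalemxAl -!scalemxAr.
rewrite -!map_mxM cross scalerA map_mxD /=.
have -> : ('i%C : R[i])^* = - 'i%C by exact: conjCi.
rewrite mulrN (_ : 'i%C * 'i%C = -1) ?opprK ?scale1r; last by rewrite -expr2 sqr_i.
by rewrite -addrA scaleNr addKr.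
Qed.

Lemma mxC_split (R : realType) m p (X : 'M[R[i]]_(m, p)) :
  X = mxC (map_mx (@complex.Re R) X) + 'i%C *: mxC (map_mx (@complex.Im R) X).
Proof. by apply/matrixP=> i j; rewrite !mxE [LHS]complexE. Qed.

Lemma herm_gt0 (R : realType) n (M : 'M[R]_n) : posdef M ->
  forall x : 'rV[R[i]]_n, x != 0 -> 0 < (x *m mxC M *m x^t*) 0 0.
Proof.
move=> [symM Mgt0] x x0; have sq0 (y : 'rV[R]_n) : 0 <= (y *m M *m y^T) 0 0 ?= iff (y == 0).
  apply/leifP; case: eqVneq => [->|y0]; first by rewrite !mul0mx mxE.
  by have := Mgt0 y^T; rewrite trmxK trmx_eq0; apply.
rewrite {1 2}(mxC_split x) hermE // !mxE ltcE /= eqxx /=.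
set u := map_mx _ _; set v := map_mx _ _.
have : (u != 0) || (v != 0).
  apply: contraNT x0; rewrite negb_or !negbK => /andP[/eqP u0 /eqP v0].
  by rewrite (mxC_split x) -/u -/v u0 v0 mxCE !map_mx0 scaler0 addr0.
have := sq0 u; have := sq0 v; rewrite !mxE.
move=> [v1 v2] [u1 u2]; case/orP=> [u0|v0]; [rewrite ltr_pwDl//|rewrite ltr_wpDl//].
  by rewrite lt_def u1 eq_sym u2 u0.
by rewrite lt_def v1 eq_sym v2 v0.
Qed.

(** Schur triangularization of [A^T] by a unitary [U] reduces the claim to [lyapunov_trig] for
    [U P U^*]; the diagonal of the triangular matrix consists of eigenvalues of [A]. *)
Lemma lyapunov_posdef (R : realType) n (A P : 'M[R]_n.+1) :
  hurwitz A -> sym_mx P -> posdef (- (A^T *m P + P *m A)) -> posdef P.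
Proof.
move=> hA symP Qgt0; split=> // x x0.
have [U Uunit] := Schur (mxC A^T) (ltn0Sn n).
have Uu := unitarymx_unit Uunit.
have UU : U^t* *m U = 1%:M by rewrite -invmx_unitary // mulVmx.
rewrite /similar_to conjymx // => trigT; set T := _ *m _ in trigT.
pose PU := U *m mxC P *m U^t*.
have TPU : T *m PU + PU *m T^t* = U *m mxC (A^T *m P + P *m A) *m U^t*.
  rewrite /T /PU !conjtM trmxCK mxC_conjt trmxK !mxCE map_mxD !map_mxM /= mulmxDr mulmxDl.
  congr (_ + _).
    by rewrite -!mulmxA [in LHS](mulmxA (U^t* )) UU mul1mx.
  by rewrite -!mulmxA [in LHS](mulmxA (U^t* )) UU mul1mx.
have := @lyapunov_trig _ _ T PU trigT.
have Tii i : T i i + (T i i)^* < 0.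
  have : eigenvalue T (T i i).
    rewrite eigenvalue_root_char char_poly_trig // /root horner_prod.
    by apply/prodf_eq0; exists i => //; rewrite !hornerE subrr.
  move/eigenvalueP=> [z zT z0].
  have : eigenvalue (mxC A^T) (T i i).
    apply/eigenvalueP; exists (z *m U); last first.
      by rewrite -(mul0mx _ U) (can_eq (mulmxK Uu)).
    by rewrite scalemxAl -zT /T -!mulmxA UU mulmx1.
  rewrite eigenvalue_root_char mxCE -map_trmx char_poly_trmx -eigenvalue_root_char.
  move/hA; have -> : T i i + (T i i)^* = 2 * toCR R (complex.Re (T i i)) by exact: addcJ.
  by move=> h; rewrite pmulr_rlt0 ?ltr0n // ltcR.
move/(_ Tii) => hPU.
have PUh : PU^t* = PU by rewrite /PU !conjtM trmxCK mxC_conjt symP mulmxA.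
have neg (y : 'rV_n.+1) : y != 0 -> (y *m (T *m PU + PU *m T^t*) *m y^t*) 0 0 < 0.
  move=> y0; rewrite TPU.
  have yU0 : y *m U != 0 by rewrite -(mul0mx _ U) (can_eq (mulmxK Uu)).
  have := herm_gt0 Qgt0 yU0; rewrite mxCE map_mxN /= mulmxN mulNmx mxE oppr_gt0.
  by rewrite conjtM !mulmxA.
have xU0 : mxC x^T *m U^t* != 0.
  rewrite -invmx_unitary // -(mul0mx _ (invmx U)) (can_eq (mulmxKV Uu)) mxCE.
  by rewrite map_mx_eq0 trmx_eq0.
have := hPU PUh neg _ xU0.
rewrite /PU conjtM trmxCK mxC_conjt trmxK -!mulmxA [U^t* *m (U *m _)]mulmxA UU mul1mx.
rewrite [U^t* *m (U *m _)]mulmxA UU mul1mx !mxCE -!map_mxM mxE ltcR.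
by rewrite mulmxA.
Qed.

(** * The least eigenvalue of a symmetric matrix *)

Lemma rnorm2E (R : realType) n (x : 'cV[R]_n) : rnorm2 x = (x^T *m x) 0 0.
Proof. by rewrite /rnorm2 mxE; apply: eq_bigr => i _; rewrite mxE. Qed.

Lemma rnorm2_ge0 (R : realType) n (x : 'cV[R]_n) : 0 <= rnorm2 x.
Proof. by apply: sumr_ge0 => i _; exact: sqr_ge0. Qed.

Lemma rnorm2_gt0 (R : realType) n (x : 'cV[R]_n) : x != 0 -> 0 < rnorm2 x.
Proof.
move=> x0; rewrite lt_def rnorm2_ge0 andbT; apply: contraNneq x0.
move=> /eqP; rewrite psumr_eq0 => [/allP h|i _]; last exact: sqr_ge0.
apply/eqP/matrixP=> i j; rewrite ord1 mxE; apply/eqP.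
by have := h i (mem_index_enum _); rewrite sqrf_eq0.
Qed.

(** Unitary diagonalization over [R[i]] has a real spectrum. Its smallest entry bounds the Rayleigh
    quotient from below and is itself an eigenvalue, so the infimum defining [lambda_min] is
    attained. *)
Lemma lambda_minP (R : realType) n (M : 'M[R]_n.+1) : sym_mx M ->
  (exists2 x : 'cV_n.+1, x != 0 & M *m x = lambda_min M *: x) /\
  forall y : 'cV_n.+1, lambda_min M * rnorm2 y <= (y^T *m M *m y) 0 0.
Proof.
move=> symM; have hM : mxC M \is hermsymmx.
  by apply/is_hermitianmxP; rewrite expr0 scale1r mxC_conjt symM.
have /orthomx_spectralP := hermitian_normalmx hM.
set U := spectralmx _; set d := spectral_diag _ => ME.
have Uunit : U \is unitarymx := spectral_unitarymx _.
have Uu := unitarymx_unit Uunit.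
have UU : U^t* *m U = 1%:M by rewrite -invmx_unitary // mulVmx.
pose r i := complex.Re (d 0 i).
have dE i : d 0 i = toCR R (r i).
  have /mxOverP/(_ 0 i) := hermitian_spectral_diag_real hM.
  by move/RRe_real => <-.
have [k _ kmin] := @Order.TotalTheory.arg_minP _ R _ (ord0 : 'I_n.+1) xpredT r isT.
have ray (y : 'cV_n.+1) : r k * rnorm2 y <= (y^T *m M *m y) 0 0.
  pose z := mxC y^T *m U^t*.
  have yy : toCR R (rnorm2 y) = \sum_i z 0 i * (z 0 i)^*.
    have -> : toCR R (rnorm2 y) = (mxC y^T *m mxC y) 0 0.
      by rewrite rnorm2E mxCE -map_mxM [RHS]mxE.
    have -> : mxC y^T *m mxC y = z *m z^t*.
      by rewrite /z conjtM trmxCK mxC_conjt trmxK mulmxA -(mulmxA _ _ U) UU mulmx1.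
    by rewrite mxE; apply: eq_bigr => i _; rewrite !mxE.
  have yMy : toCR R ((y^T *m M *m y) 0 0) = \sum_i d 0 i * (z 0 i * (z 0 i)^*).
    have -> : toCR R ((y^T *m M *m y) 0 0) = (mxC y^T *m mxC M *m mxC y) 0 0.
      by rewrite !mxCE -!map_mxM [RHS]mxE.
    have -> : mxC y^T *m mxC M *m mxC y = z *m diag_mx d *m z^t*.
      by rewrite {1}ME invmx_unitary // /z conjtM trmxCK mxC_conjt trmxK !mulmxA.
    rewrite mul_mx_diag mxE; apply: eq_bigr => i _.
    by rewrite !mxE mulrCA mulrA.
  rewrite -lecR; change (r k * rnorm2 y)%:C%C with (toCR R (r k * rnorm2 y)).
  rewrite rmorphM yMy [X in _ * X]yy mulr_sumr.
  apply: ler_sum => i _; rewrite dE ler_wpM2r ?mul_conjC_ge0 // lecR; exact: kmin.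
(* The row of [U] is only a complex eigenvector; the characteristic polynomial brings the eigenvalue
   down to [R]. *)
have eigk : eigenvalue M (r k).
  rewrite eigenvalue_root_char.
  have : eigenvalue (mxC M) (d 0 k).
    apply/eigenvalueP; exists (row k U).
      rewrite ME invmx_unitary // -row_mul !mulmxA -invmx_unitary // mulmxV // mul1mx.
      by apply/rowP=> j; rewrite mul_diag_mx !mxE.
    rewrite rowE -(mul0mx _ U) (can_eq (mulmxK Uu)).
    by apply/eqP=> /matrixP/(_ 0 k) /eqP; rewrite !mxE !eqxx oner_eq0.
  rewrite eigenvalue_root_char mxCE -map_char_poly dE /root horner_map.
  by rewrite fmorph_eq0.
have lmin : lambda_min M = r k.
  have lb : lbound [set l | eigenvalue M l] (r k).
    move=> l /eigenvalueP[z zM z0].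
    have zt0 : z^T != 0 by rewrite trmx_eq0.
    have := ray z^T; rewrite trmxK zM -scalemxAl mxE.
    by rewrite rnorm2E trmxK ler_pM2r // -[z in z *m _]trmxK -rnorm2E rnorm2_gt0.
  apply/le_anti/andP; split; last by apply: lb_le_inf => //; exists (r k).
  by apply: ge_inf => //; exists (r k).
rewrite lmin; split=> //.
have /eigenvalueP[z zM z0] := eigk; exists z^T; first by rewrite trmx_eq0.
by rewrite -{1}symM -trmx_mul zM linearZ.
Qed.

(* Locked: otherwise each rewriting attempt compares the matrix products by unfolding them. *)
HB.lock Definition dotp (R : realType) n (u x : 'cV[R]_n) : R := (u^T *m x) 0 0.
HB.lock Definition transfer_re (R : realType) n (A : 'M[R]_n) (B : 'cV[R]_n) (w : R) :
    'cV[R]_n :=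
  map_mx (@complex.Re R) (transfer A B w).
HB.lock Definition transfer_im (R : realType) n (A : 'M[R]_n) (B : 'cV[R]_n) (w : R) :
    'cV[R]_n :=
  map_mx (@complex.Im R) (transfer A B w).

(** * The transfer function on the imaginary axis *)

Lemma resolvent_unit (R : realType) n (A : 'M[R]_n) (w : R) :
  hurwitz A -> (Complex 0 w)%:M - mxC A \in unitmx.
Proof.
move=> hA; rewrite -row_free_unit -kermx_eq0; apply: contraT => ker0.
have : eigenvalue (mxC A) (Complex 0 w).
  have /rowV0Pn[v /sub_kermxP + v0] := ker0.
  rewrite mulmxBr mul_mx_scalar => /eqP; rewrite subr_eq0 => /eqP zv.
  by apply/eigenvalueP; exists v.
by move/hA; rewrite /= ltxx.
Qed.

(** Real and imaginary parts of [(jw - A) G = B]. *)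
Lemma transferE (R : realType) n (A : 'M[R]_n) (B : 'cV[R]_n) (w : R) : hurwitz A ->
  A *m transfer_re A B w = - (w *: transfer_im A B w) - B /\
  A *m transfer_im A B w = w *: transfer_re A B w.
Proof.
move=> hA; have := mulKVmx (resolvent_unit w hA) (mxC B); rewrite -/(transfer A B w).
rewrite transfer_re.unlock transfer_im.unlock; move: (transfer A B w) => G.
rewrite mulmxBl mul_scalar_mx !mxCE => eqG.
have eqi i : Complex 0 w * G i 0 - \sum_j toCR R (A i j) * G j 0 = toCR R (B i 0).
  move/matrixP/(_ i 0): eqG; rewrite !mxE => <-; congr (_ - _).
  by apply: eq_bigr => j _; rewrite mxE.
have reS i : complex.Re (\sum_j toCR R (A i j) * G j 0) =
    (A *m map_mx (@complex.Re R) G) i 0.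
  rewrite (raddf_sum (@complex.Re R : {additive Rcomplex R -> R})) mxE.
  by apply: eq_bigr => j _; rewrite mxE; case: (G j 0) => x y /=; ring.
have imS i : complex.Im (\sum_j toCR R (A i j) * G j 0) =
    (A *m map_mx (@complex.Im R) G) i 0.
  rewrite (raddf_sum (@complex.Im R : {additive Rcomplex R -> R})) mxE.
  by apply: eq_bigr => j _; rewrite mxE; case: (G j 0) => x y /=; ring.
split; apply/matrixP=> i j; rewrite ord1 {j}; have := eqi i.
  rewrite -reS => /(congr1 (@complex.Re R)); rewrite !mxE.
  by case: (\sum_j _) => sr si; case: (G i 0) => x y /=; lra.
rewrite -imS => /(congr1 (@complex.Im R)); rewrite !mxE.
by case: (\sum_j _) => sr si; case: (G i 0) => x y /=; lra.
Qed.

Lemma cnorm2E (R : realType) n (A : 'M[R]_n) (B : 'cV[R]_n) (w : R) :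
  cnorm2 (transfer A B w) = rnorm2 (transfer_re A B w) + rnorm2 (transfer_im A B w).
Proof.
rewrite transfer_re.unlock transfer_im.unlock /cnorm2 /rnorm2 -big_split.
by apply: eq_bigr => i _; rewrite !mxE.
Qed.

Lemma dot_transfer (R : realType) n (A : 'M[R]_n) (B u : 'cV[R]_n) (w : R) :
  ((mxC u)^T *m transfer A B w) 0 0 =
  Complex (dotp u (transfer_re A B w)) (dotp u (transfer_im A B w)).
Proof.
rewrite dotp.unlock transfer_re.unlock transfer_im.unlock; move: (transfer A B w) => G.
rewrite mxCE !mxE [RHS]complexE !rmorph_sum mulr_sumr -big_split /=.
apply: eq_bigr => i _; rewrite !mxE; case: (G i 0) => x y.
by apply/eqP; rewrite eq_complex /=; apply/andP; split; apply/eqP; ring.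
Qed.

Lemma ffunE (R : realType) n (A : 'M[R]_n) (B v : 'cV[R]_n) (w kappa theta : R) :
  ffun_ A B w kappa theta v =
  2 * dotp v (transfer_re A B w)
  + kappa * (dotp v (transfer_re A B w) ^+ 2 + dotp v (transfer_im A B w) ^+ 2)
  - theta * (rnorm2 (transfer_re A B w) + rnorm2 (transfer_im A B w)).
Proof. by rewrite /ffun_ dot_transfer /sqmod /= cnorm2E. Qed.

Lemma transfer_resnum (R : realType) n (A : 'M[R]_n) (B : 'cV[R]_n) (w : R) :
  hurwitz A ->
  let ev p := (map_poly (toCR R) p).[Complex 0 w] in
  ev (char_poly A) != 0 /\
  forall i, transfer A B w i 0 = ev (resnum A B i 0) / ev (char_poly A).
Proof.
move=> hA ev.
have a0 : ev (char_poly A) != 0.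
  by apply/negP=> /(hurwitz_root hA) /=; rewrite ltxx.
split=> // i.
(* Evaluation at [jw]; it turns [resnumE] into [(jw - A) N(jw) = a(jw) B]. *)
pose phi : {rmorphism {poly R} -> R[i]} :=
  (horner_eval (Complex 0 w) \o map_poly (toCR R))%FUN.
have phiC m p (M : 'M_(m, p)) : map_mx phi (map_mx polyC M) = mxC M.
  by apply/matrixP=> x y; rewrite !mxE /= map_polyC /horner_eval hornerC.
move: (resnumE A B); move: (resnum A B) => N /(congr1 (map_mx phi)).
rewrite map_mxZ map_mxD map_mxM map_mxZ !phiC.
have -> : phi 'X = Complex 0 w by rewrite /= map_polyX /horner_eval hornerX.
have -> : phi (char_poly A) = ev (char_poly A) by [].
move=> eqN; have : transfer A B w = (ev (char_poly A))^-1 *: map_mx phi N.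
  apply: (can_inj (mulKmx (resolvent_unit w hA))).
  rewrite mulKVmx ?resolvent_unit // -scalemxAr mulmxBl mul_scalar_mx eqN addrC addKr.
  by rewrite scalerA mulVf // scale1r.
by move=> ->; rewrite !mxE mulrC.
Qed.

(** * The frequency function as a ratio of real polynomials in the frequency *)

Definition rowpoly (R : realType) n (A : 'M[R]_n) (B u : 'cV[R]_n) : {poly R} :=
  (map_mx polyC u^T *m resnum A B) 0 0.

(** The polynomial [|a(jw)|^2], the common denominator of [f] and [|G|^2]. *)
Definition axis_den (R : realType) n (A : 'M[R]_n) : {poly R} :=
  axis_re (char_poly A) ^+ 2 + axis_im (char_poly A) ^+ 2.

Definition axis_norm (R : realType) n (A : 'M[R]_n) (B : 'cV[R]_n) : {poly R} :=
  \sum_i (axis_re (resnum A B i 0) ^+ 2 + axis_im (resnum A B i 0) ^+ 2).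

(** The product of [f] and [|a(jw)|^2]; with [r] the numerator of [v^T G], the first summand is
    twice the real part of [r] times the conjugate of [a]. *)
Definition axis_ffun (R : realType) n (A : 'M[R]_n) (B : 'cV[R]_n) (kappa theta : R) v :=
  2 *: (axis_re (rowpoly A B v) * axis_re (char_poly A)
        + axis_im (rowpoly A B v) * axis_im (char_poly A))
  + kappa *: (axis_re (rowpoly A B v) ^+ 2 + axis_im (rowpoly A B v) ^+ 2)
  - theta *: axis_norm A B.

Lemma axis_den_gt0 (R : realType) n (A : 'M[R]_n) (w : R) : hurwitz A -> 0 < (axis_den A).[w].
Proof.
move=> hA; have [a0 _] := transfer_resnum 0 w hA.
rewrite /axis_den !hornerE; move: a0; rewrite horner_axis eq_complex /= negb_and.
by case/orP=> h; [rewrite ltr_pwDl|rewrite ltr_wpDl]; rewrite ?sqr_ge0 ?exprn_even_gt0.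
Qed.

Lemma sqmod_div (R : realType) (z t : R[i]) : t != 0 ->
  sqmod (z / t) = sqmod z / sqmod t.
Proof.
move=> t0; have : sqmod (z / t) * sqmod t = sqmod z by rewrite -sqmodM divfK.
move=> <-; rewrite mulfK //; move: t0; case: t => a b; rewrite eq_complex /sqmod /=.
by rewrite paddr_eq0 ?sqr_ge0 // !sqrf_eq0.
Qed.

Lemma dot_rowpoly (R : realType) n (A : 'M[R]_n) (B u : 'cV[R]_n) (w : R) :
  hurwitz A ->
  let ev p := (map_poly (toCR R) p).[Complex 0 w] in
  Complex (dotp u (transfer_re A B w)) (dotp u (transfer_im A B w)) =
  ev (rowpoly A B u) / ev (char_poly A).
Proof.
move=> hA ev; have [a0 GE] := transfer_resnum B w hA.
rewrite -dot_transfer mxE /rowpoly mulmx_polyC_rV /ev rmorph_sum /= horner_sum mulr_suml.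
by apply: eq_bigr => i _; rewrite GE !mxE map_polyZ hornerZ mulrA.
Qed.

Lemma cnorm2_poly (R : realType) n (A : 'M[R]_n) (B : 'cV[R]_n) (w : R) :
  hurwitz A -> cnorm2 (transfer A B w) = (axis_norm A B).[w] / (axis_den A).[w].
Proof.
move=> hA; have [a0 GE] := transfer_resnum B w hA.
rewrite /cnorm2 /axis_norm horner_sum mulr_suml; apply: eq_bigr => i _.
by rewrite GE sqmod_div // !horner_axis /sqmod /axis_den !hornerE.
Qed.

Lemma ffun_poly (R : realType) n (A : 'M[R]_n) (B v : 'cV[R]_n) (w kappa theta : R) :
  hurwitz A ->
  ffun_ A B w kappa theta v = (axis_ffun A B kappa theta v).[w] / (axis_den A).[w].
Proof.
move=> hA; have [a0 _] := transfer_resnum B w hA.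
rewrite /ffun_ cnorm2_poly // dot_transfer dot_rowpoly // sqmod_div // !horner_axis.
have := axis_den_gt0 w hA; rewrite /axis_ffun /axis_den /sqmod /= !hornerE.
set p := (axis_re (rowpoly _ _ _)).[w]; set q := (axis_im (rowpoly _ _ _)).[w].
set a := (axis_re _).[w]; set b := (axis_im (char_poly _)).[w] => E0.
have {E0} : a ^+ 2 + b ^+ 2 != 0 by rewrite gt_eqF.
by move=> E0; rewrite /=; field.
Qed.

(** * Ratios of polynomials: limit at infinity and uniform lower bound *)

(** Reversing coefficients writes each polynomial as [x ^+ m] times a polynomial in [x^-1], which is
    continuous at 0. The degree of [p] may be below [m]; the limit is then 0. *)
Lemma cvg_ratio_poly (R : realType) (p q : {poly R}) (m : nat) :
  (size p <= m.+1)%N -> (size q <= m.+1)%N -> q`_m != 0 ->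
  p.[x] / q.[x] @[x --> +oo%R] --> (p`_m / q`_m : R).
Proof.
move=> szp szq qm0.
pose rv (r : {poly R}) := \poly_(i < m.+1) r`_(m - i)%N.
have rvE (r : {poly R}) x : (size r <= m.+1)%N -> x != 0 -> r.[x] = x ^+ m * (rv r).[x^-1].
  move=> szr x0; rewrite (horner_coef_wide _ szr) horner_poly mulr_sumr.
  rewrite (reindex_inj rev_ord_inj) /=; apply: eq_bigr => i _.
  rewrite subSS mulrCA; congr (_ * _).
  by rewrite exprVn expfB_cond ?(negPf x0) // add0n -ltnS.
have rv0 (r : {poly R}) : (rv r).[0] = r`_m by rewrite horner_coef0 coef_poly subn0.
have inv0 : x^-1 @[x --> +oo%R] --> (0 : R).
  apply/(gtr0_cvgV0 (f := id)); last exact: cvg_id.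
  by near=> x; near: x; exact: nbhs_pinfty_gt.
have rvcvg (r : {poly R}) : (rv r).[x^-1] @[x --> +oo%R] --> (r`_m : R).
  rewrite -rv0; apply: (cvg_comp _ _ inv0); exact: continuous_horner.
apply: (cvg_trans _ (cvgM (rvcvg p) (cvgV qm0 (rvcvg q)))).
apply: near_eq_cvg; near=> x.
have x0 : x != 0 by rewrite gt_eqF //; near: x; exact: nbhs_pinfty_gt.
by rewrite /= (rvE p) // (rvE q) // -mulf_div divff ?mul1r // expf_neq0.
Unshelve. all: by end_near. Qed.

(** The ratio exceeds [l / 2] near infinity and attains a positive minimum on the remaining compact
    interval; evenness covers negative arguments. Halving that minimum makes the inequality
    strict. *)
Lemma even_ratio_lower (R : realType) (p q : {poly R}) (l : R) :
  (forall x, 0 < p.[x]) -> (forall x, 0 < q.[x]) ->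
  (forall x, p.[- x] = p.[x]) -> (forall x, q.[- x] = q.[x]) ->
  0 < l -> p.[x] / q.[x] @[x --> +oo%R] --> (l : R) ->
  exists2 psi : R, 0 < psi & forall x, 0 < p.[x] - psi * q.[x].
Proof.
move=> p0 q0 pe qe l0 cvgl.
have half (x : R) : 0 < x -> x / 2 < x.
  by move=> x0; rewrite ltr_pdivrMr // ltr_pMr // ltr1n.
have [M [_ hM]] := cvgr_gt _ cvgl _ (half _ l0).
pose M1 := Num.max 0 M.
have M10 : 0 <= M1 by rewrite le_max lexx.
have [c _ hc] : exists2 c, c \in `[0, M1]%R &
    forall t, t \in `[0, M1]%R -> p.[c] / q.[c] <= p.[t] / q.[t].
  apply: EVT_min => //; apply: continuous_subspaceT => x.
  apply: cvgM; first exact: continuous_horner.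
  by apply: cvgV; [rewrite gt_eqF|exact: continuous_horner].
pose psi := Num.min (l / 2) (p.[c] / q.[c] / 2).
have psi0 : 0 < psi by rewrite lt_min !divr_gt0.
have pos x : 0 <= x -> psi < p.[x] / q.[x].
  move=> x0; have [xM|Mx] := leP x M1.
    apply: (@lt_le_trans _ _ (p.[c] / q.[c])); last by apply: hc; rewrite in_itv /= x0.
    rewrite gt_min; apply/orP; right.
    by rewrite half // divr_gt0.
  apply: (@le_lt_trans _ _ (l / 2)); first by rewrite ge_min lexx.
  by apply: hM; apply: le_lt_trans Mx; rewrite le_max lexx orbT.
exists psi => // x; rewrite subr_gt0 -ltr_pdivlMr //.
have [x0|x0] := leP 0 x; first exact: pos.
by rewrite -pe -qe; apply: pos; rewrite oppr_ge0 ltW.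
Qed.

Lemma coefM_top (R : realType) (p q : {poly R}) (m k : nat) :
  (size p <= m.+1)%N -> (size q <= k.+1)%N -> (p * q)`_(m + k) = p`_m * q`_k.
Proof.
move=> szp szq; rewrite coefM (bigD1 (Ordinal (leq_addr k m : m < (m + k).+1)%N)) //=.
rewrite addKn big1 ?addr0 // => i /eqP im; have [ltim|lemi] := ltnP i m.
  rewrite [q`_ _]nth_default ?mulr0 //; apply: leq_trans szq _.
  by lia.
rewrite nth_default ?mul0r //; apply: leq_trans szp _.
by rewrite ltn_neqAle lemi andbT; apply/eqP => mi; apply: im; apply: val_inj.
Qed.

(** * Degree, parity and top coefficients of these polynomials in dimension [n.+1] *)

Section AxisPolynomials.
Variables (R : realType) (n : nat) (A : 'M[R]_n.+1) (B : 'cV[R]_n.+1).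

Lemma size_sqr_le (p : {poly R}) : (size p <= n.+1)%N -> (size (p ^+ 2) <= n.*2.+1)%N.
Proof.
move=> szp; apply: leq_trans (size_polyMleq _ _) _.
by rewrite -addnn; lia.
Qed.

Lemma size_axis_norm : (size (axis_norm A B) <= n.*2.+1)%N.
Proof.
apply: leq_trans (size_sum _ _ _) _; apply/bigmax_leqP=> i _.
apply: leq_trans (size_polyD _ _) _; rewrite geq_max !size_sqr_le //.
  exact: leq_trans (size_axis_im _) (size_resnum _ _ _).
exact: leq_trans (size_axis_re _) (size_resnum _ _ _).
Qed.

(** Compare coefficients of degree [n.+1] in [resnumE]: [A N] has none by [size_resnum], and the
    characteristic polynomial is monic of that degree. *)
Lemma coef_resnum i : (resnum A B i 0)`_n = B i 0.
Proof.
move: (resnum A B) (size_resnum A B) (resnumE A B) => N szN.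
move=> /matrixP/(_ i 0) /(congr1 (fun p : {poly R} => p`_n.+1)).
rewrite !mxE coefXM coefD coef_sum big1 ?add0r /= => [eqN|j _]; last first.
  by rewrite mxE mul_polyC coefZ nth_default ?mulr0.
rewrite eqN mulrC mul_polyC coefZ.
have -> : (char_poly A)`_n.+1 = 1.
  by have /monicP := char_poly_monic A; rewrite lead_coefE size_char_poly.
by rewrite mulr1.
Qed.

Lemma coef_axis_norm : (axis_norm A B)`_n.*2 = rnorm2 B.
Proof.
rewrite /axis_norm coef_sum; apply: eq_bigr => i _.
have szN := size_resnum A B i.
have sj := leq_trans (size_axis_re (resnum A B i 0)) szN.
have si := leq_trans (size_axis_im (resnum A B i 0)) szN.
rewrite coefD !expr2 -addnn !coefM_top // !coef_poly.
(* If the numerator has size at most [n], its coefficient [n] is the default 0, and so is [B i 0] by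
   [coef_resnum]. *)
case: ltnP => [_|le]; last by rewrite -coef_resnum nth_default // !mulr0 addr0.
rewrite coef_resnum.
have := sqmodM ('i%C ^+ n : R[i]) 1.
have : sqmod ('i%C ^+ n : R[i]) = 1.
  elim: (n) => [|k IH]; first by rewrite expr0 /sqmod /= expr1n expr0n addr0.
  by rewrite exprS sqmodM IH /sqmod /= expr0n expr1n add0r mulr1.
rewrite /sqmod; set u := complex.Re _; set w := complex.Im _ => uw _.
by rewrite -[RHS]mulr1 -uw; ring.
Qed.

(** A zero would force [G(jw) = 0], hence [B = (jw - A) G(jw) = 0]. *)
Lemma axis_norm_gt0 w : hurwitz A -> B != 0 -> 0 < (axis_norm A B).[w].
Proof.
move=> hA B0; rewrite lt_def; apply/andP; split; last first.
  by rewrite horner_sum; apply: sumr_ge0 => i _; rewrite !hornerE addr_ge0 ?sqr_ge0.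
apply: contraNneq B0 => D0.
have := cnorm2_poly B w hA; rewrite D0 mul0r cnorm2E => /eqP.
rewrite paddr_eq0 ?rnorm2_ge0 // => /andP[g1 g2].
have z (x : 'cV[R]_n.+1) : rnorm2 x == 0 -> x = 0.
  by move=> x0; apply/eqP; apply: contraTT x0 => /rnorm2_gt0/gt_eqF ->.
have [] := transferE B w hA; rewrite (z _ g1) (z _ g2) mulmx0 scaler0 oppr0 add0r => /eqP.
by rewrite eq_sym oppr_eq0.
Qed.

Lemma axis_norm_even w : (axis_norm A B).[- w] = (axis_norm A B).[w].
Proof.
rewrite !horner_sum; apply: eq_bigr => i _.
by rewrite !hornerE axis_re_even axis_im_odd sqrrN.
Qed.

Lemma axis_ffun_even (kappa theta w : R) v :
  (axis_ffun A B kappa theta v).[- w] = (axis_ffun A B kappa theta v).[w].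
Proof.
by rewrite /axis_ffun !(hornerE, axis_re_even, axis_im_odd, axis_norm_even, sqrrN, mulrNN).
Qed.

(** The products with [char_poly A] only give degree at most [2n + 1]; evenness kills this odd
    coefficient. *)
Lemma size_axis_ffun (kappa theta : R) v : (size (axis_ffun A B kappa theta v) <= n.*2.+1)%N.
Proof.
have szp : (size (rowpoly A B v) <= n.+1)%N := size_mul_resnum _ _ _.
have sj := leq_trans (size_axis_re _) szp; have si := leq_trans (size_axis_im _) szp.
have szj : (size (axis_re (char_poly A)) <= n.+2)%N.
  by apply: leq_trans (size_axis_re _) _; rewrite size_char_poly.
have szi : (size (axis_im (char_poly A)) <= n.+2)%N.
  by apply: leq_trans (size_axis_im _) _; rewrite size_char_poly.
have prod (p q : {poly R}) : (size p <= n.+1)%N -> (size q <= n.+2)%N ->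
    (size (p * q)%R <= n.*2.+2)%N.
  by move=> a b; apply: leq_trans (size_polyMleq _ _) _; rewrite -addnn; lia.
have sz2 : (size (axis_ffun A B kappa theta v) <= n.*2.+2)%N.
  rewrite /axis_ffun; apply: leq_trans (size_polyD _ _) _; rewrite geq_max size_polyN.
  apply/andP; split; last first.
    exact: leq_trans (size_scale_leq _ _) (leq_trans size_axis_norm (leqnSn _)).
  apply: leq_trans (size_polyD _ _) _; rewrite geq_max; apply/andP; split.
    apply: leq_trans (size_scale_leq _ _) _; apply: leq_trans (size_polyD _ _) _.
    by rewrite geq_max !prod.
  apply: leq_trans (size_scale_leq _ _) _; apply: leq_trans (size_polyD _ _) _.
  by rewrite geq_max !(leq_trans (size_sqr_le _)).
rewrite leqNgt; apply/negP => gt; have szE : size (axis_ffun A B kappa theta v) = n.*2.+2.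
  by apply/eqP; rewrite eqn_leq sz2.
have : lead_coef (axis_ffun A B kappa theta v) = 0.
  rewrite lead_coefE szE; apply: coef_odd_even_poly => [w|]; first by rewrite axis_ffun_even.
  by rewrite /= odd_double.
by move/eqP; rewrite lead_coef_eq0 -size_poly_eq0 szE.
Qed.

End AxisPolynomials.

(** * Quadratic forms and inner products *)

HB.lock Definition quad (R : realType) n (M : 'M[R]_n) (x : 'cV[R]_n) : R :=
  (x^T *m M *m x) 0 0.

Section QuadDot.
Variables (R : realType) (n : nat).
Implicit Types (M N : 'M[R]_n) (x u v : 'cV[R]_n).

Lemma quadE M x : quad M x = (x^T *m M *m x) 0 0.
Proof. by rewrite quad.unlock. Qed.

Lemma quadD M N x : quad (M + N) x = quad M x + quad N x.
Proof. by rewrite quad.unlock mulmxDr mulmxDl mxE. Qed.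

Lemma quadZ a M x : quad (a *: M) x = a * quad M x.
Proof. by rewrite quad.unlock -scalemxAr -scalemxAl mxE. Qed.

Lemma quadN M x : quad (- M) x = - quad M x.
Proof. by rewrite -scaleN1r quadZ mulN1r. Qed.

Lemma quad_scalar a x : quad a%:M x = a * rnorm2 x.
Proof. by rewrite -scalemx1 quadZ rnorm2E quad.unlock mulmx1. Qed.

Lemma dotpC u x : dotp u x = dotp x u.
Proof. by rewrite dotp.unlock !mxE; apply: eq_bigr => i _; rewrite !mxE mulrC. Qed.

Lemma quad_rank1 v x : quad (v *m v^T) x = dotp v x ^+ 2.
Proof.
rewrite quad.unlock mulmxA -mulmxA mxE big_ord_recl big_ord0 addr0.
by rewrite [dotp v x]dotpC expr2; congr (_ * _); [|rewrite dotpC]; rewrite dotp.unlock.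
Qed.

Lemma dotpDr u x y : dotp u (x + y) = dotp u x + dotp u y.
Proof. by rewrite dotp.unlock mulmxDr mxE. Qed.

Lemma dotpDl u v x : dotp (u + v) x = dotp u x + dotp v x.
Proof. by rewrite ![dotp _ x]dotpC dotpDr. Qed.

Lemma dotpZr a u x : dotp u (a *: x) = a * dotp u x.
Proof. by rewrite dotp.unlock -scalemxAr mxE. Qed.

Lemma dotpNr u x : dotp u (- x) = - dotp u x.
Proof. by rewrite -scaleN1r dotpZr mulN1r. Qed.

Lemma dotpNl u x : dotp (- u) x = - dotp u x.
Proof. by rewrite dotpC dotpNr dotpC. Qed.

Lemma dotp_mulmx M u x : dotp u (M *m x) = dotp (M^T *m u) x.
Proof. by rewrite dotp.unlock trmx_mul trmxK mulmxA. Qed.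

Lemma rnorm2_dotp x : rnorm2 x = dotp x x.
Proof. by rewrite dotp.unlock rnorm2E. Qed.

Lemma cauchy_schwarz u x : dotp u x ^+ 2 <= rnorm2 u * rnorm2 x.
Proof.
have [->|u0] := eqVneq u 0.
  by rewrite dotp.unlock trmx0 mul0mx mxE expr0n /= mulr_ge0 ?rnorm2_ge0.
have := rnorm2_ge0 (rnorm2 u *: x - dotp u x *: u).
have -> : rnorm2 (rnorm2 u *: x - dotp u x *: u) =
    rnorm2 u * (rnorm2 u * rnorm2 x - dotp u x ^+ 2).
  rewrite [LHS]rnorm2_dotp dotpDr !dotpNr !dotpZr.
  rewrite ![dotp (_ - _) _]dotpC !dotpDr !dotpNr !dotpZr [dotp x u]dotpC -!rnorm2_dotp.
  by ring.
by rewrite pmulr_rge0 ?rnorm2_gt0 // subr_ge0.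
Qed.

Lemma quad_lyapunov (A P : 'M[R]_n) x : sym_mx P ->
  quad (A^T *m P + P *m A) x = 2 * dotp (P *m x) (A *m x).
Proof.
move=> symP; rewrite quadD mulr2n mulrDl mul1r; congr (_ + _).
  by rewrite dotpC dotp.unlock trmx_mul quad.unlock !mulmxA.
by rewrite dotp.unlock trmx_mul symP quad.unlock !mulmxA.
Qed.

End QuadDot.

(** * The Lyapunov identity along the transfer function, and realization of factors *)

(** Substitute [A G = jw G - B]; the terms in [w] cancel by symmetry of [P]. *)
Lemma lyapunov_transfer (R : realType) n (A P : 'M[R]_n) (B : 'cV[R]_n) w :
  hurwitz A -> sym_mx P ->
  quad (A^T *m P + P *m A) (transfer_re A B w) + quad (A^T *m P + P *m A) (transfer_im A B w) =
  - (2 * dotp (P *m B) (transfer_re A B w)).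
Proof.
move=> hA symP; have [E1 E2] := transferE B w hA.
rewrite !quad_lyapunov // E1 E2 dotpDr !dotpNr !dotpZr.
have -> : dotp (P *m transfer_re A B w) (transfer_im A B w) =
    dotp (P *m transfer_im A B w) (transfer_re A B w).
  by rewrite dotpC dotp_mulmx symP.
have -> : dotp (P *m transfer_re A B w) B = dotp (P *m B) (transfer_re A B w).
  by rewrite dotpC dotp_mulmx symP.
by ring.
Qed.

Lemma transfer_parity (R : realType) n (A : 'M[R]_n) (B u : 'cV[R]_n) w :
  hurwitz A ->
  dotp u (transfer_re A B (- w)) = dotp u (transfer_re A B w) /\
  dotp u (transfer_im A B (- w)) = - dotp u (transfer_im A B w).
Proof.
move=> hA; have /= E1 := dot_rowpoly B u w hA.
have /= := dot_rowpoly B u (- w) hA.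
have -> : Complex 0 (- w) = conjc (Complex 0 w) by [].
have conj_div (z t : R[i]) : conjc z / conjc t = conjc (z / t) by rewrite rmorphM /= conjc_inv.
have conj_inj (a b c d : R) : Complex a b = conjc (Complex c d) -> a = c /\ b = - d.
  by case=> -> ->.
rewrite 2!horner_conj conj_div -E1; exact: conj_inj.
Qed.

(** Both [axis_re p] and [axis_im p] vanish, and the real and imaginary parts of ['i ^+ k] are never
    both zero. *)
Lemma poly_axis_eq0 (R : realType) (p : {poly R}) :
  (forall w, (map_poly (toCR R) p).[Complex 0 w] = 0) -> p = 0.
Proof.
move=> p0.
have jre0 : axis_re p = 0.
  by apply: horner_ext => w; have := p0 w; rewrite horner_axis horner0 => -[].
have jim0 : axis_im p = 0.
  by apply: horner_ext => w; have := p0 w; rewrite horner_axis horner0 => -[].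
apply/polyP=> k; rewrite coef0; have [kp|] := ltnP k (size p); last exact: nth_default.
have := congr1 (fun q : {poly R} => q`_k) jre0; have := congr1 (fun q : {poly R} => q`_k) jim0.
rewrite !coef_poly kp !coef0 => e1 e2; apply/eqP; case: eqVneq => // pk0.
have : ('i%C ^+ k : R[i]) == 0.
  rewrite eq_complex /=; move/eqP: e2; rewrite mulf_eq0 (negPf pk0) /= => ->.
  by move/eqP: e1; rewrite mulf_eq0 (negPf pk0) /= => ->.
by rewrite expf_eq0 eq_complex /= oner_eq0 !andbF.
Qed.

(* The function r/a = q^T (s - A)^-1 B has vanishing real part on the imaginary axis, so
   r(s) a(-s) + r(-s) a(s) = 0; since a(s) and a(-s) are coprime, a divides r. *)
Lemma dotp_transfer_re_eq0 (R : realType) n (A : 'M[R]_n) (B q : 'cV[R]_n) :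
  hurwitz A -> controllable A B -> (forall w, dotp q (transfer_re A B w) = 0) -> q = 0.
Proof.
move=> hA ctr q0; pose r := rowpoly A B q; pose a := char_poly A.
have T0 : r * (a \Po - 'X) + (r \Po - 'X) * a = 0.
  apply: poly_axis_eq0 => w.
  rewrite rmorphD !rmorphM /= !map_comp_poly rmorphN /= map_polyX !hornerE !horner_comp.
  rewrite !hornerE; have -> : - Complex 0 w = conjc (Complex 0 w) :> R[i].
    by apply/eqP; rewrite eq_complex /= oppr0 !eqxx.
  rewrite !horner_conj; have [a0 _] := transfer_resnum B w hA.
  have := dot_rowpoly B q w hA; rewrite -/r -/a q0 /= => raE.
  have -> : (map_poly (toCR R) r).[Complex 0 w] =
      Complex 0 (dotp q (transfer_im A B w)) * (map_poly (toCR R) a).[Complex 0 w].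
    by rewrite raE mulfVK.
  case: ((map_poly (toCR R) a).[_]) => x y.
  by apply/eqP; rewrite eq_complex /=; apply/andP; split; apply/eqP; ring.
have r0 : r = 0.
  have ar : a %| r.
    rewrite -(Gauss_dvdpl _ (hurwitz_coprime hA)) -/a.
    by move/eqP: T0; rewrite addr_eq0 => /eqP ->; rewrite dvdpNr dvdp_mulIr.
  apply/eqP; case: eqVneq => // rn0; have := dvdp_leq rn0 ar.
  by rewrite size_char_poly leqNgt ltnS size_mul_resnum.
apply: trmx_inj; rewrite trmx0; apply: (resnum_inj ctr); apply/matrixP=> i j.
by rewrite !ord1 [RHS]mxE -[RHS]r0.
Qed.

Lemma controllable_neq0 (R : realType) n (A : 'M[R]_n.+1) (B : 'cV[R]_n.+1) :
  controllable A B -> B != 0.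
Proof.
move=> ctr; apply/eqP => B0; move: ctr; rewrite /controllable.
have -> : ctrb A B = 0 by apply/matrixP=> i j; rewrite mxE B0 mulmx0 !mxE.
by rewrite mxrank0.
Qed.

(** Rank is invariant under field extension; the complex form is needed to realize the complex
    spectral factor. *)
Lemma rank_ctrbC (R : realType) n (A : 'M[R]_n) (B : 'cV[R]_n) :
  controllable A B -> \rank (\matrix_(i, j) ((mxC A ^+ j) *m mxC B) i 0 : 'M_n) = n.
Proof.
move=> ctr; rewrite -[RHS]ctr -(mxrank_map (toCR R) (ctrb A B)).
have mxCX k : mxC A ^+ k = mxC (A ^+ k).
  elim: k => [|k IH]; first by rewrite !expr0 -!idmxE mxCE map_mx1.
  by rewrite !exprS IH -!mulmxE !mxCE map_mxM.
congr (\rank _); apply/matrixP=> i j.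
by rewrite mxE mxCX !mxCE -map_mxM [LHS]mxE [RHS]mxE; congr (toCR R _); rewrite [RHS]mxE.
Qed.

Lemma mulmx_rV_cV (C : fieldType) n (c : 'rV[C]_n) (x : 'cV[C]_n) :
  (c *m x) 0 0 = \sum_i c 0 i * x i 0.
Proof. by rewrite mxE. Qed.

(* If p = |H|^2 and c + j d realizes H/a as an output of the system, the values of
   |(c + j d)^T G|^2 at w and -w agree and their average has no cross terms. *)
Lemma realize_factor (R : realType) n (A : 'M[R]_n.+1) (B : 'cV[R]_n.+1) (p : {poly R}) :
  hurwitz A -> controllable A B -> (forall x, 0 < p.[x]) -> (forall x, p.[- x] = p.[x]) ->
  (size p <= n.*2.+1)%N ->
  exists c d : 'cV[R]_n.+1, forall w,
    quad (c *m c^T + d *m d^T) (transfer_re A B w) +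
    quad (c *m c^T + d *m d^T) (transfer_im A B w) =
    p.[w] / (axis_den A).[w].
Proof.
move=> hA ctr p_gt0 p_even szp.
have [H [HE szH]] := spectral_factor p_gt0.
(* The rotation of the variable makes [h(jw) = H(w)]. *)
pose h : {poly R[i]} := H \Po (- 'i%C *: 'X).
have szh : (size h <= n.+1)%N.
  have i0 : (- 'i%C : R[i]) != 0 by rewrite oppr_eq0 eq_complex /= oner_eq0 andbF.
  rewrite size_comp_poly2; last by rewrite size_scale // size_polyX.
  by rewrite -leq_double (leq_trans szH) // doubleS ltnS.
have hjw w : h.[Complex 0 w] = H.[toCR R w].
  rewrite horner_comp !hornerE; congr (H.[_]).
  by apply/eqP; rewrite eq_complex /=; apply/andP; split; apply/eqP; ring.
have [c cN] := resnum_surj (rank_ctrbC ctr) szh.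
pose c1 := (map_mx (@complex.Re R) c)^T; pose c2 := (map_mx (@complex.Im R) c)^T.
have cG w : sqmod (Complex (dotp c1 (transfer_re A B w) - dotp c2 (transfer_im A B w))
                           (dotp c1 (transfer_im A B w) + dotp c2 (transfer_re A B w))) =
            p.[w] / (axis_den A).[w].
  have [a0 GE] := transfer_resnum B w hA.
  have -> : Complex (dotp c1 (transfer_re A B w) - dotp c2 (transfer_im A B w))
      (dotp c1 (transfer_im A B w) + dotp c2 (transfer_re A B w)) = (c *m transfer A B w) 0 0.
    have -> : (c *m transfer A B w) 0 0 =
        ((mxC c1)^T *m transfer A B w) 0 0 + 'i%C * ((mxC c2)^T *m transfer A B w) 0 0.
      rewrite /c1 /c2 !mxCE -!map_trmx !trmxK -!mxCE [in LHS](mxC_split c) mulmxDl mxE.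
      by rewrite -scalemxAl [X in _ + X]mxE.
    rewrite !dot_transfer.
    by apply/eqP; rewrite eq_complex /=; apply/andP; split; apply/eqP; ring.
  have -> : (c *m transfer A B w) 0 0 =
      h.[Complex 0 w] / (map_poly (toCR R) (char_poly A)).[Complex 0 w].
    rewrite -cN mulmx_polyC_rV mulmx_rV_cV horner_sum mulr_suml.
    apply: eq_bigr => i _; rewrite GE hornerZ mulrA; congr (_ * _.[_] / _).
    by rewrite !mxCE map_resnum [RHS]mxE.
  by rewrite sqmod_div // hjw HE horner_axis /sqmod /axis_den !hornerE.
clearbody c1 c2; exists c1, c2 => w; rewrite !quadD !quad_rank1.
have dE : (axis_den A).[- w] = (axis_den A).[w].
  by rewrite !hornerE axis_re_even axis_im_odd sqrrN.
have := cG (- w); have := cG w; rewrite p_even dE.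
have [-> ->] := transfer_parity B c1 w hA; have [-> ->] := transfer_parity B c2 w hA.
by rewrite /sqmod /= => <-; lra.
Qed.

(** * The matrix inequality and the frequency condition *)

Section LMI.
Variables (R : realType) (n : nat) (A : 'M[R]_n.+1) (B v : 'cV[R]_n.+1) (kappa : R).
Hypotheses (hA : hurwitz A) (ctr : controllable A B) (kappa_gt0 : 0 < kappa).

Let theta := kappa * rnorm2 v.

Lemma LMI_quad psi P x : LMI A B v kappa psi P ->
  quad (A^T *m P + P *m A) x + (psi + theta) * rnorm2 x <= kappa * dotp v x ^+ 2.
Proof.
move=> [[_ lmi] _]; have := lmi x; rewrite -quadE !quadD quadN quad_scalar quadZ quad_rank1.
by rewrite subr_le0 -!quadD.
Qed.

(** Add the inequality at the real and imaginary parts of [G], and use [lyapunov_transfer] with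
    [P B = v]. *)
Lemma LMI_ffun psi P w : sym_mx P -> LMI A B v kappa psi P ->
  psi * cnorm2 (transfer A B w) <= ffun_ A B w kappa theta v.
Proof.
move=> symP lmi; have [_ PB] := lmi.
have := LMI_quad (transfer_re A B w) lmi; have := LMI_quad (transfer_im A B w) lmi.
have := lyapunov_transfer B w hA symP; rewrite PB ffunE cnorm2E.
by lra.
Qed.

Lemma cnorm2_gt0 w : 0 < cnorm2 (transfer A B w).
Proof.
by rewrite cnorm2_poly // divr_gt0 ?axis_den_gt0 // axis_norm_gt0 // (controllable_neq0 ctr).
Qed.

Lemma ratio_poly w th : (cnorm2 (transfer A B w))^-1 * ffun_ A B w kappa th v =
  (axis_ffun A B kappa th v).[w] / (axis_norm A B).[w].
Proof.
have D0 : (axis_norm A B).[w] != 0.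
  by rewrite gt_eqF // axis_norm_gt0 // (controllable_neq0 ctr).
have E0 : (axis_den A).[w] != 0 by rewrite gt_eqF // axis_den_gt0.
by rewrite cnorm2_poly // ffun_poly //; field; rewrite D0 E0.
Qed.

(** The limit exists as a ratio of coefficients of degree [2n], the lower one being [rnorm2 B]. It
    is positive since the ratio is at least [psi] at every frequency by [LMI_ffun]. *)
Lemma feasible_frequency :
  PsiSet A B v kappa !=set0 ->
  (forall w : R, 0 < ffun_ A B w kappa theta v) /\
  (exists2 l : R, 0 < l &
     (cnorm2 (transfer A B w))^-1 * ffun_ A B w kappa theta v
          @[w --> +oo%R] --> (l : R)).
Proof.
move=> [psi [psi0 [P [symP lmi]]]]; split=> [w|].
  by apply: lt_le_trans (LMI_ffun w symP lmi); rewrite mulr_gt0 ?cnorm2_gt0.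
have B0 := controllable_neq0 ctr.
pose l := (axis_ffun A B kappa theta v)`_n.*2 / (axis_norm A B)`_n.*2.
have cv : (cnorm2 (transfer A B w))^-1 * ffun_ A B w kappa theta v
          @[w --> +oo%R] --> (l : R).
  under eq_fun do rewrite ratio_poly.
  apply: cvg_ratio_poly; [exact: size_axis_ffun|exact: size_axis_norm|].
  by rewrite coef_axis_norm gt_eqF // rnorm2_gt0.
exists l => //; rewrite ltNge; apply/negP => l0.
have [w] := filter_ex (cvgr_lt _ cv _ (le_lt_trans l0 psi0)).
apply/negP; rewrite -leNgt mulrC ler_pdivlMr ?cnorm2_gt0 //.
exact: LMI_ffun symP lmi.
Qed.

Lemma frequency_feasible :
  (forall w : R, 0 < ffun_ A B w kappa theta v) ->
  (exists2 l : R, 0 < l &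
     (cnorm2 (transfer A B w))^-1 * ffun_ A B w kappa theta v
          @[w --> +oo%R] --> (l : R)) ->
  PsiSet A B v kappa !=set0.
Proof.
move=> f0 [l l0]; under eq_fun do rewrite ratio_poly; move=> cv.
have F0 w : 0 < (axis_ffun A B kappa theta v).[w].
  by have := f0 w; rewrite ffun_poly // pmulr_lgt0 // invr_gt0 axis_den_gt0.
have D0 w : 0 < (axis_norm A B).[w] by rewrite axis_norm_gt0 // (controllable_neq0 ctr).
have [psi psi0 gap] :=
  even_ratio_lower F0 D0 (fun w => axis_ffun_even A B _ _ w v) (axis_norm_even A B) l0 cv.
pose p := axis_ffun A B kappa theta v - psi *: axis_norm A B.
have px w : p.[w] = (axis_ffun A B kappa theta v).[w] - psi * (axis_norm A B).[w].
  by rewrite /p !hornerE.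
have p0 w : 0 < p.[w] by rewrite px.
have pe w : p.[- w] = p.[w] by rewrite !px axis_ffun_even axis_norm_even.
have szp : (size p <= n.*2.+1)%N.
  apply: leq_trans (size_polyD _ _) _; rewrite geq_max size_axis_ffun size_polyN.
  exact: leq_trans (size_scale_leq _ _) (size_axis_norm _ _).
have [c [d cdE]] := realize_factor hA ctr p0 pe szp.
pose S := c *m c^T + d *m d^T; rewrite -/S in cdE.
(* Solving with right side [- (M + S)] makes the left side of the LMI exactly [- S]. *)
pose M := (psi + theta)%:M - kappa *: (v *m v^T).
have symS : sym_mx S by rewrite /sym_mx /S linearD /= !trmx_mul !trmxK.
have symM : sym_mx M.
  by rewrite /sym_mx /M linearB /= linearZ /= tr_scalar_mx trmx_mul trmxK.
have symMS : sym_mx (- (M + S)) by rewrite /sym_mx linearN linearD /= symM symS.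
have [P symP PE] := lyapunov_solve hA symMS.
(* By the choice of [c] and [d], the form of [S] at [G] is [f - psi |G|^2]; adding that of [M]
   leaves twice the real part of [v^T G], which the Lyapunov identity equates with twice the real
   part of [(P B)^T G]. *)
have PB : P *m B = v.
  apply/eqP; rewrite -subr_eq0; apply/eqP; apply: (dotp_transfer_re_eq0 hA ctr) => w.
  have := lyapunov_transfer B w hA symP; rewrite PE !quadN !quadD.
  have := cdE w; rewrite px mulrBl -ffun_poly // -mulrA -cnorm2_poly // ffunE cnorm2E.
  rewrite /M !quadD !quadN !quad_scalar !quadZ !quad_rank1 dotpDl dotpNl.
  by lra.
exists psi; split=> //; exists P; split=> //; split=> //.
have -> : A^T *m P + P *m A + (psi + kappa * rnorm2 v)%:M - kappa *: (v *m v^T) = - S.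
  by rewrite PE -addrA -/theta -/M opprD addrC addNKr.
split; first by rewrite /sym_mx linearN /= symS.
move=> x; rewrite -quadE quadN quadD !quad_rank1 oppr_le0.
by rewrite addr_ge0 ?sqr_ge0.
Qed.

(** Cauchy-Schwarz absorbs the [kappa] term into [theta |x|^2], leaving [x^T Q x >= psi |x|^2]. *)
Lemma LMI_posdefQ psi P : 0 < psi -> sym_mx P -> LMI A B v kappa psi P ->
  posdef (- (A^T *m P + P *m A)).
Proof.
move=> psi0 symP lmi; split.
  by rewrite /sym_mx linearN linearD /= !trmx_mul trmxK symP addrC.
move=> x x0; rewrite -quadE quadN.
have := LMI_quad x lmi; have := cauchy_schwarz v x; have := rnorm2_gt0 x0.
rewrite /theta => r0 cs q.
have : kappa * dotp v x ^+ 2 <= kappa * (rnorm2 v * rnorm2 x) by rewrite ler_pM2l.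
have : 0 < psi * rnorm2 x by rewrite mulr_gt0.
by move: q; rewrite mulrDl mulrA; lra.
Qed.

Lemma LMI_lambda_min psi P : sym_mx P -> LMI A B v kappa psi P ->
  let Q := - (A^T *m P + P *m A) in
  (exists w : R, ffun_ A B w 0 (psi + theta) v < 0) ->
  lambda_min Q < lambda_min (Q + P *m B *m B^T *m P).
Proof.
move=> symP lmi Q [w fw]; have [_ PB] := lmi.
have symQ : sym_mx Q by rewrite /sym_mx linearN linearD /= !trmx_mul trmxK symP addrC.
have -> : P *m B *m B^T *m P = v *m v^T.
  by rewrite -mulmxA -{2}symP -trmx_mul PB.
have symQv : sym_mx (Q + v *m v^T) by rewrite /sym_mx linearD /= symQ trmx_mul trmxK.
have [[x x0 xE] _] := lambda_minP symQv; have [_ rayQ] := lambda_minP symQ.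
move: (lambda_min Q) (lambda_min (Q + _)) rayQ xE => mu nu rayQ xE.
have XQ y : quad (A^T *m P + P *m A) y = - quad Q y by rewrite /Q quadN opprK.
rewrite ltNge; apply/negP => nu_mu.
have qx : quad Q x + dotp v x ^+ 2 = nu * rnorm2 x.
  by rewrite -quad_rank1 -quadD quadE -mulmxA xE -scalemxAr mxE rnorm2E.
have r0 := rnorm2_gt0 x0.
have nu_mu' : nu * rnorm2 x <= mu * rnorm2 x by rewrite ler_pM2r.
have {}rayQ y : mu * rnorm2 y <= quad Q y by rewrite quadE.
(* The form of [Q] at [x] is at least [mu |x|^2], while adding the square gives [nu |x|^2], which is
   no larger. *)
have vx : dotp v x ^+ 2 = 0.
  by apply/le_anti; rewrite sqr_ge0 andbT; have := rayQ x; lra.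
have mu_ge : psi + theta <= mu.
  rewrite -(ler_pM2r r0); have := LMI_quad x lmi; rewrite XQ vx mulr0.
  by rewrite vx addr0 in qx; lra.
have norm_le y : (psi + theta) * rnorm2 y <= quad Q y.
  by apply: le_trans (rayQ y); rewrite ler_wpM2r ?rnorm2_ge0.
(* Twice the real part of [v^T G] equals the form of [Q] at [G], now at least [(psi + theta) |G|^2],
   against the sign of [f] at [w]. *)
have := lyapunov_transfer B w hA symP; rewrite PB !XQ.
have := norm_le (transfer_re A B w); have := norm_le (transfer_im A B w).
by move: fw; rewrite ffunE mul0r; lra.
Qed.

End LMI.

Theorem theorem3 (R : realType) (n : nat) (A : 'M[R]_n.+1) (B v : 'cV[R]_n.+1)
    (kappa : R) :
  hurwitz A -> controllable A B -> 0 < kappa ->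
  (PsiSet A B v kappa !=set0 <->
     (forall w : R, 0 < ffun_ A B w kappa (kappa * rnorm2 v) v) /\
     (exists2 l : R, 0 < l &
        (cnorm2 (transfer A B w))^-1 * ffun_ A B w kappa (kappa * rnorm2 v) v
          @[w --> +oo%R] --> (l : R))) /\
  (PsiSet A B v kappa !=set0 ->
     forall (psi : R) (P : 'M[R]_n.+1),
       PsiSet A B v kappa psi -> sym_mx P -> LMI A B v kappa psi P ->
       let Q := - (A^T *m P + P *m A) in
       posdef P /\ posdef Q /\
       ((exists w : R, ffun_ A B w 0 (psi + kappa * rnorm2 v) v < 0) ->
          lambda_min Q < lambda_min (Q + P *m B *m B^T *m P))).
Proof.
move=> hA ctr kappa_gt0; split.
  split; first exact: feasible_frequency.
  by case; exact: frequency_feasible.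
move=> _ psi P [psi0 _] symP lmi Q.
have Q_gt0 : posdef Q := LMI_posdefQ kappa_gt0 psi0 symP lmi.
split; first exact: lyapunov_posdef symP Q_gt0.
by split=> //; exact: LMI_lambda_min.
Qed.
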